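(* Let $X$ be Hilbert and let the Lipschitz-regularizer assumption in the context hold. Let $q\in W$, $t>0$, and $\gamma>0$ with $\gamma t\|T\|^2\le1$, and let $(y^j,\mu^j)_{j\ge0}$ be generated from $\mu^0\in\operatorname{dom}R^*$ by $$y^j=q-tT^\star\mu^j,\qquad \mu^{j+1}=\operatorname{prox}_{\gamma R^*}(\mu^j+\gamma Ty^j).$$ Let $\mu_\star$ be a minimizer of $H$ and $y_\star$ the unique minimizer of $\Psi_{q,t}$. Then all gaps $\mathcal G_{q,t}(y^j,\mu^j)$ are finite and tend to zero. For every $j\ge1$, $$0\le H(\mu^j)-H(\mu_\star)\le\frac{\|\mu^0-\mu_\star\|_X^2}{2\gamma j},$$ $$\|y^j-y_\star\|_W\le\sqrt{\frac{t}{\gamma j}}\,\|\mu^0-\mu_\star\|_X,$$ $$0\le\mathcal G_{q,t}(y^j,\mu^j)\le\frac{2L_R}{\gamma}\|\mu^j-\mu^{j-1}\|_X .$$ In particular, for every $j\ge2$, $$\mathcal G_{q,t}(y^j,\mu^j)\le\frac{4L_R\|\mu^0-\mu_\star\|_X}{\gamma(j-1)} .$$ Thus the inner approximation property (stated in the context) holds with these pairs. With them, the stationarity-test procedure (stated in the context), at any $w$ and any tolerance $\varepsilon>0$, and every relative test at a nonstationary point $w$ and any $t>0$, terminate after finitely many inner iterations.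
   Context: $W,X$ are real Hilbert spaces, $T:W\to X$ is bounded and linear, $T^\star:X\to W$ its Hilbert adjoint; dual vectors are identified with elements $\mu\in X$. $\varphi=R\circ T$. Lipschitz-regularizer assumption: $R:X\to\mathbb R$ is (finite) convex and globally Lipschitz with constant $L_R<\infty$; the values of $R$, finite values of $R^*$, and the proximal map of $R^*$ in $X$ can be evaluated (a computational availability assumption); a starting point $\mu^0\in\operatorname{dom}R^*$ is available. Here $R^*(\mu)=\sup_{x\in X}((\mu,x)_X-R(x))$, and $\operatorname{prox}_{\gamma R^*}(\nu)$ is the unique minimizer over $\mu\in X$ of $R^*(\mu)+\frac1{2\gamma}\|\mu-\nu\|_X^2$. $\Psi_{q,t}(y)=\frac1{2t}\|y-q\|_W^2+R(Ty)$ and $H(\mu)=\frac t2\|T^\star\mu\|_W^2-(\mu,Tq)_X+R^*(\mu)$ (the negative of the dual objective; it has a minimizer). The gap is $\mathcal G_{q,t}(y,\mu)=\Psi_{q,t}(y)+H(\mu)$. $f:W\to\mathbb R$ is continuously Fréchet differentiable with Hilbert gradient $\nabla f$ globally Lipschitz with constant $L_f\ge0$, and $f+\varphi$ is bounded below by a finite number. Fixed parameters $\tau>0$, $0<\sigma<1$. A point $w\in W$ is stationary if $0\in f'(w)+\partial\varphi(w)$; equivalently $p(w;t)=0$ for one (every) $t>0$, where $p(w;t)=\arg\min_{s\in W}\{(\nabla f(w),s)_W+\frac1{2t}\|s\|_W^2+\varphi(w+s)\}$. Inner approximation property: for every $w\in\operatorname{dom}\varphi$ and $t>0$, with $q=w-t\nabla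 f(w)$, the procedure produces pairs $(y^j,\mu^j)$ with finite gaps and $\mathcal G_{q,t}(y^j,\mu^j)\to0$, and the gap (or a rigorous upper bound tending to zero) is available for testing. Relative test at $(w,t)$: $\mathcal G_{q,t}(y^j,\mu^j)\le\frac{\sigma^2}{2t}\|y^j-w\|_W^2$ with $q=w-t\nabla f(w)$. Stationarity-test procedure at $w$ with tolerance $\varepsilon>0$: with $t=\tau$, $q=w-\tau\nabla f(w)$, at each pair stop if $\frac{\|y^j-w\|_W}{\tau}+\sqrt{2\mathcal G_{q,\tau}(y^j,\mu^j)/\tau}\le\varepsilon$; otherwise stop if the relative test at $(w,\tau)$ holds; otherwise pass to $j+1$. *)

(* Defs.v *)
From HB Require Import structures.
From mathcomp Require Import all_boot all_order all_algebra sesquilinear.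
From mathcomp Require Import all_classical all_reals all_analysis.

Set Implicit Arguments.
Unset Strict Implicit.
Unset Printing Implicit Defensive.

Import Order.TTheory GRing.Theory Num.Theory.
Import numFieldNormedType.Exports.

Local Open Scope classical_set_scope.
Local Open Scope ring_scope.

HB.mixin Record hasInnerProduct (K : realType) V of CompleteNormedModule K V := {
  inner : {dot V for (@idfun K)};
  inner_norm : forall x : V, inner x x = `|x| ^+ 2
}.

#[short(type="hilbertType")]
HB.structure Definition Hilbert (K : realType) :=
  {V of hasInnerProduct K V & CompleteNormedModule K V}.

Definition is_minimizer d (S : porderType d) (E : Type) (F : E -> S) (x : E) :=
  forall z : E, (F x <= F z)%O.

Section Hilbert_notions.
Variables (K : realType) (W X : hilbertType K).

Definition is_adjoint (T : W -> X) (Ts : X -> W) :=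
  forall (w : W) (x : X), inner (T w) x = inner w (Ts x).

(* For unbounded T the supremum is the junk value 0; opnorm is only used for
   bounded T. *)
Definition opnorm (T : W -> X) : K := sup [set `|T w| | w in [set w | `|w| <= 1]].

Definition is_gradient (f : W -> K^o) (gradf : W -> W) :=
  forall w : W, is_diff w f (inner (gradf w)).

Definition subdifferential (phi : W -> K) (w : W) : set W :=
  [set g | forall v : W, phi w + inner g (v - w) <= phi v].

(* 0 \in f'(w) + \partial phi(w), dual vectors being identified with
   elements of W *)
Definition stationary (gradf : W -> W) (phi : W -> K) (w : W) :=
  exists2 g : W, subdifferential phi w g & gradf w + g = 0.

Definition conjugate (R : X -> K) (mu : X) : \bar K :=
  ereal_sup (range (fun x : X => (inner mu x - R x)%:E)).

Definition edom (F : X -> \bar K) : set X := [set mu | (F mu < +oo)%E].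

(* The minimizer is unique whenever F is proper, convex and lower
   semicontinuous; the default value 0 stands for a missing minimizer. *)
Definition prox (gamma : K) (F : X -> \bar K) (nu : X) : X :=
  xget 0 (is_minimizer
    (fun mu : X => F mu + ((2 * gamma)^-1 * `|mu - nu| ^+ 2)%:E)%E).

End Hilbert_notions.

Section Inner_problem.
Variables (K : realType) (W X : hilbertType K).
Variables (T : W -> X) (Ts : X -> W) (R : X -> K).

Definition primal_obj (q : W) (t : K) (y : W) : K :=
  (2 * t)^-1 * `|y - q| ^+ 2 + R (T y).

Definition neg_dual_obj (q : W) (t : K) (mu : X) : \bar K :=
  ((t / 2 * `|Ts mu| ^+ 2 - inner mu (T q))%:E + conjugate R mu)%E.

Definition gap (q : W) (t : K) (y : W) (mu : X) : \bar K :=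
  ((primal_obj q t y)%:E + neg_dual_obj q t mu)%E.

Definition primal_of (q : W) (t : K) (mu : X) : W := q - t *: Ts mu.

Fixpoint dual_iterate (q : W) (t gamma : K) (mu0 : X) (j : nat) : X :=
  if j is i.+1 then
    let mu := dual_iterate q t gamma mu0 i in
    prox gamma (conjugate R) (mu + gamma *: T (primal_of q t mu))
  else mu0.

Definition primal_iterate (q : W) (t gamma : K) (mu0 : X) (j : nat) : W :=
  primal_of q t (dual_iterate q t gamma mu0 j).

(* The arguments gamma and mu0 pick a step size and a starting point for every
   point w and every t. *)
Definition inner_pairs (gradf : W -> W) (gamma : W -> K -> K) (mu0 : W -> K -> X)
    (w : W) (t : K) (j : nat) : W * X :=
  let q := w - t *: gradf w in
  (primal_iterate q t (gamma w t) (mu0 w t) j,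
   dual_iterate q t (gamma w t) (mu0 w t) j).

Variable gradf : W -> W.

(* R \o T is finite everywhere, so w ranges over all of W. *)
Definition inner_approximation (pairs : W -> K -> nat -> W * X) :=
  forall (w : W) (t : K), 0 < t ->
  let G j := gap (w - t *: gradf w) t (pairs w t j).1 (pairs w t j).2 in
  (forall j, G j \is a fin_num) /\ G j @[j --> \oo] --> 0%E.

Definition relative_test (sigma : K) (w : W) (t : K) (p : W * X) :=
  let q := w - t *: gradf w in
  (gap q t p.1 p.2 <= (sigma ^+ 2 / (2 * t) * `|p.1 - w| ^+ 2)%:E)%E.

Definition tolerance_test (tau eps : K) (w : W) (p : W * X) :=
  let q := w - tau *: gradf w in
  ((`|p.1 - w| / tau)%:E + sqrte ((2 / tau)%:E * gap q tau p.1 p.2) <= eps%:E)%E.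

(* The procedure scans j = 0, 1, 2, ... and stops at the first j that passes
   one of its two tests. *)
Definition stationarity_test_terminates (tau sigma eps : K) (w : W)
    (pairs : W -> K -> nat -> W * X) :=
  exists j : nat, tolerance_test tau eps w (pairs w tau j) \/
                  relative_test sigma w tau (pairs w tau j).

Definition relative_test_terminates (sigma : K) (w : W) (t : K)
    (pairs : W -> K -> nat -> W * X) :=
  exists j : nat, relative_test sigma w t (pairs w t j).

End Inner_problem.

(* Main.v *)
Require Import Defs.
From mathcomp Require Import all_boot all_order all_algebra sesquilinear.
From mathcomp Require Import all_classical all_reals all_analysis.
From mathcomp Require Import ring lra zify.

Set Implicit Arguments.
Unset Strict Implicit.
Unset Printing Implicit Defensive.

Import Order.TTheory GRing.Theory Num.Theory.
Import numFieldNormedType.Exports.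

Local Open Scope classical_set_scope.
Local Open Scope ring_scope.

(** The iteration is the proximal gradient method for the dual problem
    [min H], with [-T y^j] the gradient of the smooth part of [H] at [mu^j].

    Each dual proximal step is resolved through the primal one. By Moreau's
    decomposition every [nu] in [X] splits as [p + gamma u] with [p] a
    subgradient of [R] at [u], where [u] minimizes a strongly convex continuous
    function; then [p] is the proximal point of [R^*] at [nu]
    ([moreau_decomposition], [prox_conjugate]). Hence [mu^(j+1)] comes with a
    point [u] such that [R^*(mu^(j+1)) = (mu^(j+1), u) - R(u)]. Subgradients of
    [R] have norm at most [L_R], and
    [T y^(j+1) - u = gamma^-1 (I - gamma t T Ts) (mu^(j+1) - mu^j)], where
    [I - gamma t T Ts] is nonexpansive; this bounds the gap by
    [2 L_R / gamma] times the last dual step ([gap_le_step]).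

    Everything then follows from the one-step inequality [dual_descent]:
    [H(mu^(j+1)) + |z - mu^(j+1)|^2 / (2 gamma)
      <= H(z) + |z - mu^j|^2 / (2 gamma)] for every [z].
    With [z = mu^j] it says that the squared steps are summable, because weak
    duality bounds [H] from below; so the steps and the gaps tend to zero.
    With [z = mustar] it telescopes into the
    [1/j] rate for the dual values. Since a vanishing gap forces strong duality,
    and the gap at [(y, mu)] dominates [|y - (q - t Ts mu)|^2 / (2 t)]
    ([gap_ge]), the dual rate turns into the primal one. The steps are moreover
    nonincreasing, which gives them, hence the gap, a rate [1/j]
    ([fejer_step_rate]).

    Termination is by contradiction: if the relative test fails for every [j],
    then [y^j] tends to [w]. The tolerance test then succeeds eventually;
    and [w] minimizes [Psi], being the limit of a minimizing sequence, which
    makes it stationary. *)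

(** * Inner products *)

Section Inner_product.
Variables (K : realType) (V : hilbertType K).
Implicit Types (x y z : V) (a : K).

Lemma innerC x y : inner x y = inner y x.
Proof. by rewrite hermC expr0 mul1r. Qed.

Lemma innerDl x y z : inner (x + y) z = inner x z + inner y z.
Proof. exact: linearDl. Qed.

Lemma innerDr x y z : inner z (x + y) = inner z x + inner z y.
Proof. exact: linearDr. Qed.

Lemma innerNl x z : inner (- x) z = - inner x z.
Proof. exact: linearNl. Qed.

Lemma innerNr x z : inner z (- x) = - inner z x.
Proof. exact: linearNr. Qed.

Lemma innerZl a x z : inner (a *: x) z = a * inner x z.
Proof. exact: linearZl_LR. Qed.

Lemma innerZr a x z : inner z (a *: x) = a * inner z x.
Proof. by rewrite innerC innerZl innerC. Qed.

Definition innerE :=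
  (innerDl, innerDr, innerNl, innerNr, innerZl, innerZr).

Lemma sqnormD x y : `|x + y| ^+ 2 = `|x| ^+ 2 + 2 * inner x y + `|y| ^+ 2.
Proof. by rewrite -!inner_norm !innerE (innerC y x); ring. Qed.

Lemma sqnormZ a x : `|a *: x| ^+ 2 = a ^+ 2 * `|x| ^+ 2.
Proof. by rewrite -!inner_norm !innerE; ring. Qed.

Lemma inner_le_norm x y : inner x y <= `|x| * `|y|.
Proof.
have [->|x0] := eqVneq x 0.
  by rewrite -(scale0r 0) innerZl mul0r mulr_ge0.
have [->|y0] := eqVneq y 0.
  by rewrite -(scale0r 0) innerZr mul0r mulr_ge0.
(* The squared norm of [|y| x - |x| y] is [2 |x| |y| (|x| |y| - (x, y))]. *)
have xy0 : 0 < `|x| * `|y| by rewrite mulr_gt0 ?normr_gt0.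
have := sqr_ge0 `| `|y| *: x - `|x| *: y|.
rewrite -inner_norm !innerE !inner_norm (innerC y x) => h.
by rewrite -(ler_pM2l xy0); lra.
Qed.

Lemma inner_separated x y : (forall z, inner z x = inner z y) -> x = y.
Proof.
move=> h; apply/eqP; rewrite -subr_eq0 -normr_eq0 -sqrf_eq0 -inner_norm.
by rewrite !innerE !h; apply/eqP; ring.
Qed.

End Inner_product.

(** * A bounded operator and its adjoint *)

Section Adjoint.
Variables (K : realType) (W X : hilbertType K).
Variables (T : {linear W -> X}) (Ts : X -> W).
Hypothesis T_bounded : bounded_near T (nbhs (0 : W)).
Hypothesis Ts_adjoint : is_adjoint T Ts.

Let opnorm_set := [set `|T w| | w in [set w | `|w| <= 1]].

Let opnorm_has_ub : has_ubound opnorm_set.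
Proof.
have [M [_ hM]] := proj1 (linear_boundedP T) T_bounded.
have M1 : M < `|M| + 1 by rewrite (le_lt_trans (ler_norm _))// ltrDl.
exists (`|M| + 1) => _ [w /= w1 <-].
apply: (le_trans (hM _ M1 w)).
by rewrite -[leRHS]mulr1 ler_wpM2l// addr_ge0.
Qed.

Lemma opnorm_ge0 : 0 <= opnorm T.
Proof.
by apply: (ub_le_sup opnorm_has_ub); exists 0; rewrite /= ?linear0 normr0.
Qed.

Lemma norm_le_opnorm w : `|T w| <= opnorm T * `|w|.
Proof.
have [->|w0] := eqVneq w 0; first by rewrite linear0 !normr0 mulr0.
have nw0 : 0 < `|w| by rewrite normr_gt0.
rewrite -ler_pdivrMr// mulrC -[X in X * _]gtr0_norm ?invr_gt0// -normrZ.
rewrite -linearZ; apply: (ub_le_sup opnorm_has_ub); eexists => //=.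
by rewrite normrZ gtr0_norm ?invr_gt0// mulVf ?gt_eqF.
Qed.

Lemma adjointD x y : Ts (x + y) = Ts x + Ts y.
Proof.
by apply: inner_separated => w; rewrite innerDr -!Ts_adjoint innerDr.
Qed.

Lemma adjointZ a x : Ts (a *: x) = a *: Ts x.
Proof.
by apply: inner_separated => w; rewrite innerZr -!Ts_adjoint innerZr.
Qed.

Lemma adjointB x y : Ts (x - y) = Ts x - Ts y.
Proof. by rewrite adjointD -scaleN1r adjointZ scaleN1r. Qed.

Lemma adjoint_norm x : `|Ts x| <= opnorm T * `|x|.
Proof.
have [->|n0] := eqVneq (Ts x) 0.
  by rewrite normr0 mulr_ge0 ?opnorm_ge0.
have p0 : 0 < `|Ts x| by rewrite normr_gt0.
rewrite -(ler_pM2r p0) -expr2 -inner_norm -Ts_adjoint.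
apply: (le_trans (inner_le_norm _ _)).
rewrite -[leRHS]mulrA (mulrC `|x|) mulrA ler_wpM2r//.
exact: norm_le_opnorm.
Qed.

Section Step_size.
Variables (s : K).
Hypotheses (s_ge0 : 0 <= s) (s_small : s * opnorm T ^+ 2 <= 1).

Lemma step_adjoint_le d : s * `|Ts d| ^+ 2 <= `|d| ^+ 2.
Proof.
apply: (@le_trans _ _ (s * opnorm T ^+ 2 * `|d| ^+ 2)); last first.
  by rewrite -[leRHS]mul1r ler_wpM2r// sqr_ge0.
rewrite -mulrA ler_wpM2l// -exprMn ler_sqr ?nnegrE ?mulr_ge0 ?opnorm_ge0//.
exact: adjoint_norm.
Qed.

(** Expanding the square, the cross term is [- 2 s |Ts d|^2] and the last one
    is at most [s |Ts d|^2]: the map is the identity minus a positive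
    operator bounded by the identity. *)
Lemma forward_step_nonexpansive d : `|d - s *: T (Ts d)| <= `|d|.
Proof.
rewrite -ler_sqr ?nnegrE// -scaleNr sqnormD sqnormZ innerZr (innerC d).
rewrite Ts_adjoint inner_norm.
have : s ^+ 2 * `|T (Ts d)| ^+ 2 <= s * `|Ts d| ^+ 2.
  rewrite expr2 -mulrA ler_wpM2l//.
  apply: (@le_trans _ _ (s * opnorm T ^+ 2 * `|Ts d| ^+ 2)); last first.
    by rewrite -[leRHS]mul1r ler_wpM2r// sqr_ge0.
  rewrite -mulrA ler_wpM2l// -exprMn ler_sqr ?nnegrE ?mulr_ge0 ?opnorm_ge0//.
  exact: norm_le_opnorm.
have : 0 <= s * `|Ts d| ^+ 2 by rewrite mulr_ge0 ?sqr_ge0.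
by rewrite sqrrN; lra.
Qed.

End Step_size.

End Adjoint.

(** * Strong convexity and proximal points *)

Section Strongly_convex.
Variables (K : realType) (V : hilbertType K).

(** Strong midpoint convexity makes every minimizing sequence Cauchy, so
    completeness alone yields a minimizer. *)
Lemma midpoint_strong_convexity_minimizer (F : V -> K) (c m : K) :
    0 < c -> continuous (F : V -> K^o) -> (forall x, m <= F x) ->
    (forall x y, F (2^-1 *: (x + y)) + c * `|x - y| ^+ 2 <= (F x + F y) / 2) ->
  exists u, forall x, F u <= F x.
Proof.
move=> c0 F_cont F_ge F_mid.
set I := inf (range F).
have F_inf : has_inf (range F).
  by split; [exists (F 0), 0 | exists m => _ [x _ <-]].
have I_le x : I <= F x by apply: (ge_inf (proj2 F_inf)); exists x.
have /choice[s sI] n : exists x, F x < I + n.+1%:R^-1.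
  have n0 : 0 < n.+1%:R^-1 :> K by [].
  by have [_ [x _ <-] ?] := inf_adherent n0 F_inf; exists x.
have s_dist n i j : (n <= i)%N -> (n <= j)%N ->
    c * `|s i - s j| ^+ 2 <= n.+1%:R^-1.
  move=> ni nj; have := F_mid (s i) (s j); have := I_le (2^-1 *: (s i + s j)).
  have le_inv k : (n <= k)%N -> F (s k) <= I + n.+1%:R^-1.
    move=> nk; apply/ltW/(lt_le_trans (sI k)).
    by rewrite lerD2l lef_pV2 ?posrE ?ler_nat.
  have := le_inv _ ni; have := le_inv _ nj; move: (n.+1%:R^-1) => a.
  lra.
have s_cvg : cvg (s @ \oo).
  apply/cauchy_cvgP/cauchy_ballP => e e0 /=.
  have ce0 : 0 < c * e ^+ 2 by rewrite mulr_gt0 ?exprn_gt0.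
  have [N _ hN] := near_infty_natSinv_lt (PosNum ce0).
  exists (s @` [set n | (N <= n)%N], s @` [set n | (N <= n)%N]) => /=.
    by split; exists N => // n Nn; exists n.
  case=> _ _ [/= [i Ni <-] [j Nj <-]]; rewrite -ball_normE /ball_ /=.
  have := le_lt_trans (s_dist _ _ _ Ni Nj) (hN _ (leqnn N)).
  by rewrite /= ltr_pM2l// ltr_sqr ?nnegrE// ltW.
exists (lim (s @ \oo)) => x; apply: (le_trans _ (I_le x)).
have Fs_cvg : (F (s n) : K^o) @[n --> \oo] --> (F (lim (s @ \oo)) : K^o).
  exact: (continuous_cvg _ (F_cont _) s_cvg).
apply/ler_addgt0Pr => e e0.
rewrite -(cvg_lim _ Fs_cvg)//; apply: limr_le; first by apply: cvgP Fs_cvg.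
near=> n; apply/ltW/(lt_le_trans (sI n)); rewrite lerD2l ltW//.
by near: n; exact: (near_infty_natSinv_lt (PosNum e0)).
Unshelve. all: by end_near. Qed.

(** Convexity written along the segment from [x] to [y], with a plain scalar
    in place of an element of the unit interval type. *)
Definition convex_on_segments (F : V -> K) := forall x y s, 0 <= s -> s <= 1 ->
  F (x + s *: (y - x)) <= F x + s * (F y - F x).

Lemma convex_function_on_segments (F : V -> K^o) :
  convex_function [set: convex_lmodType V] F -> convex_on_segments F.
Proof.
move=> Fc x y s s0 s1.
have s01 : Itv.spec (@Itv.num_sem _) (Itv.Real `[0, 1]%Z) s.
  by rewrite /= /Itv.num_sem /= num_real in_itv /= s0 s1.
have h : F (s *: y + (1 - s) *: x) <= s * F y + (1 - s) * F x.
  exact: (Fc (Itv.mk s01) y x (mem_set I) (mem_set I)).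
have -> : x + s *: (y - x) = s *: y + (1 - s) *: x.
  by rewrite scalerBr scalerBl scale1r addrCA (addrC x).
by apply: (le_trans h); lra.
Qed.

(** First-order optimality: comparing the minimizer [w] with [w + s (x - w)]
    and dividing by [s] leaves the subgradient inequality up to
    [s c / 2 |x - w|^2], which vanishes with [s]. *)
Lemma prox_optimality (F : V -> K) (c : K) (z w : V) :
    0 <= c -> convex_on_segments F ->
    (forall x, F w + c / 2 * `|w - z| ^+ 2 <= F x + c / 2 * `|x - z| ^+ 2) ->
  subdifferential F w (c *: (z - w)).
Proof.
move=> c0 Fc w_min x.
set B := c / 2 * `|x - w| ^+ 2; set A := F x - (F w + inner (c *: (z - w)) (x - w)).
have B0 : 0 <= B by rewrite mulr_ge0 ?sqr_ge0// divr_ge0.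
have key s : 0 < s -> s <= 1 -> 0 <= A + s * B.
  move=> s0 s1; have := Fc w x s (ltW s0) s1.
  have := w_min (w + s *: (x - w)).
  have -> : w + s *: (x - w) - z = (w - z) + s *: (x - w) by rewrite addrAC.
  rewrite (sqnormD (w - z)) sqnormZ innerZr.
  rewrite -(pmulr_rge0 _ s0) /A /B innerZl -(opprB w z) innerNl; lra.
suff : 0 <= A by rewrite subr_ge0.
rewrite leNgt; apply/negP => A0.
have [B1|B1] := leP B (- A / 2).
  by have := key 1 ltr01 (lexx _); lra.
(* [s = - A / (2 B)] makes [A + s B] equal to [A / 2 < 0]. *)
have B2 : 0 < B by apply: le_lt_trans B1; lra.
have := key (- A / 2 / B); rewrite divr_gt0 ?ler_pdivrMr ?mul1r ?divfK ?gt_eqF//; lra.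
Qed.

End Strongly_convex.

(** * Conjugate functions and Moreau's decomposition *)

Section Conjugate.
Variables (K : realType) (X : hilbertType K) (R : X -> K).

Lemma fenchel_young mu x : ((inner mu x - R x)%:E <= conjugate R mu)%E.
Proof. by apply: ereal_sup_ubound; exists x. Qed.

Lemma conjugate_subdifferential u p : subdifferential R u p ->
  conjugate R p = (inner p u - R u)%:E.
Proof.
move=> pu; apply/eqP; rewrite eq_le fenchel_young andbT.
apply: ge_ereal_sup => _ [x _ <-]; rewrite lee_fin.
by have := pu x; rewrite innerDr innerNr; lra.
Qed.

Lemma conjugate_neq_ninfty mu : conjugate R mu != -oo%E.
Proof. by have := fenchel_young mu 0; case: conjugate. Qed.

Lemma conjugate_fin_num mu : edom (conjugate R) mu -> conjugate R mu \is a fin_num.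
Proof.
by rewrite fin_numE conjugate_neq_ninfty /edom /= => /lt_eqF ->.
Qed.

(** Moving from [u] in the direction [p] itself makes [R] grow by at least
    [|p|^2] and at most [L |p|]. *)
Lemma subdifferential_norm L u p : (forall x y, `|R x - R y| <= L * `|x - y|) ->
  0 <= L -> subdifferential R u p -> `|p| <= L.
Proof.
move=> R_lip L0 pu; have [->|p0] := eqVneq p 0; first by rewrite normr0.
have np0 : 0 < `|p| by rewrite normr_gt0.
rewrite -(ler_pM2r np0) -expr2 -inner_norm.
have := pu (u + p); have := R_lip (u + p) u; rewrite addrAC subrr add0r.
have := ler_norm (R (u + p) - R u); lra.
Qed.

(** Fenchel-Young at the single point [u] turns the proximal objective of the
    conjugate into a function that grows at least quadratically around [p],
    which gives both minimality and uniqueness. *)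
Lemma prox_conjugate gamma nu u p : 0 < gamma ->
  nu = p + gamma *: u -> subdifferential R u p ->
  prox gamma (conjugate R) nu = p.
Proof.
move=> g0 nuE pu; set c := (2 * gamma)^-1.
have c0 : 0 < c by rewrite invr_gt0 mulr_gt0.
have growth z : (conjugate R p + (c * `|p - nu| ^+ 2)%:E + (c * `|z - p| ^+ 2)%:E
    <= conjugate R z + (c * `|z - nu| ^+ 2)%:E)%E.
  apply: (@le_trans _ _ ((inner z u - R u)%:E + (c * `|z - nu| ^+ 2)%:E)%E).
    rewrite (conjugate_subdifferential pu) -!EFinD lee_fin.
    have -> : z - nu = (z - p) + - (gamma *: u).
      by rewrite nuE opprD addrA.
    have -> : p - nu = - (gamma *: u) by rewrite nuE opprD addrA subrr add0r.
    rewrite (sqnormD (z - p)) !innerE; set a := inner z u; set b := inner p u.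
    have cg : 2 * c * gamma = 1 by rewrite /c; field; rewrite gt_eqF.
    have : 2 * c * gamma * (a - b) = a - b by rewrite cg mul1r.
    lra.
  by rewrite leeD2r// fenchel_young.
apply: xget_subset1.
  move=> z; apply: le_trans (growth z).
  by rewrite leeDl// lee_fin mulr_ge0 ?sqr_ge0// ltW.
have uniq z : is_minimizer (fun mu : X =>
    conjugate R mu + (c * `|mu - nu| ^+ 2)%:E)%E z -> z = p.
  move=> /(_ p) /(le_trans (growth z)).
  rewrite (conjugate_subdifferential pu) -!EFinD lee_fin gerDl pmulr_rle0//.
  by rewrite real_exprn_even_le0//= normr_eq0 subr_eq0 => /eqP.
by move=> z1 z2 /uniq-> /uniq->.
Qed.

Lemma lipschitz_bound_continuous (L : K) :
  (forall x y, `|R x - R y| <= L * `|x - y|) -> continuous (R : X -> K^o).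
Proof.
move=> R_lip x; apply/cvgrPdist_le => e e0; near=> y.
apply: (le_trans (R_lip _ _)).
apply: (@le_trans _ _ ((`|L| + 1) * `|x - y|)).
  by rewrite ler_wpM2r// (le_trans (ler_norm _))// lerDl.
rewrite mulrC -ler_pdivlMr; last by rewrite ltr_wpDl.
near: y; apply: cvgr_dist_le; first exact: cvg_id.
by rewrite divr_gt0// ltr_wpDl.
Unshelve. all: by end_near. Qed.

(** The point [u] is the proximal point of [R] at [nu / gamma], and [p] the
    subgradient that its optimality condition provides. *)
Lemma moreau_decomposition L gamma nu : 0 < gamma ->
    convex_on_segments R -> (forall x y, `|R x - R y| <= L * `|x - y|) ->
  exists u p, nu = p + gamma *: u /\ subdifferential R u p.
Proof.
move=> g0 R_convex R_lip; pose z := gamma^-1 *: nu.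
pose F x := R x + gamma / 2 * `|x - z| ^+ 2.
have F_cont : continuous (F : X -> K^o).
  move=> x; apply: (@cvgD K K^o); first exact: lipschitz_bound_continuous R_lip x.
  apply: (@cvgM K); first exact: cvg_cst.
  rewrite expr2; under eq_fun do rewrite expr2.
  have h : (`|y - z| : K^o) @[y --> x] --> (`|x - z| : K^o).
    apply: cvg_norm; apply: cvgB; [exact: cvg_id|exact: cvg_cst].
  exact: (@cvgM K _ _ _ _ _ _ _ h h).
have [||||u u_min] := @midpoint_strong_convexity_minimizer K X F (gamma / 8)
  (R z - L ^+ 2 / (2 * gamma)) => //.
- by rewrite divr_gt0.
(* The lower bound completes the square in
   [R x >= R z - L |x - z|]. *)
- move=> x; rewrite /F; set r := `|x - z|.
  have : R z - R x <= L * r.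
    by apply: le_trans (ler_norm _) _; rewrite /r distrC; exact: R_lip.
  have : 0 <= gamma / 2 * (r - L / gamma) ^+ 2.
    by rewrite mulr_ge0 ?sqr_ge0 ?divr_ge0 ?ltW.
  have -> : gamma / 2 * (r - L / gamma) ^+ 2
    = gamma / 2 * r ^+ 2 - L * r + L ^+ 2 / (2 * gamma) by field; rewrite gt_eqF.
  lra.
- move=> x y; rewrite /F.
  have := R_convex x y 2^-1; rewrite invr_ge0 ler0n invf_le1// ler1n => /(_ isT isT).
  have -> : x + 2^-1 *: (y - x) = 2^-1 *: (x + y).
    rewrite scalerBr scalerDr addrA addrAC; congr (_ + _).
    by rewrite -[X in X - _]scale1r -scalerBl; congr (_ *: _); field.
  have -> : 2^-1 *: (x + y) - z = 2^-1 *: ((x - z) + (y - z)).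
    rewrite addrACA -opprD [in RHS]scalerBr; congr (_ - _).
    by rewrite -(mulr2n z) -(scaler_nat 2 z) scalerA mulVf ?scale1r.
  have -> : x - y = (x - z) - (y - z) by rewrite opprB addrA subrK.
  move: (x - z) (y - z) => a b.
  rewrite sqnormZ !sqnormD innerNr normrN; lra.
exists u, (gamma *: (z - u)); split.
  by rewrite scalerBr subrK /z scalerA divff ?scale1r ?gt_eqF.
exact: (prox_optimality (ltW g0) R_convex).
Qed.

End Conjugate.

(** * Rates for descent sequences *)

Lemma sqr_cvg0 (K : realType) (u : nat -> K) : (forall j, 0 <= u j) ->
  u j ^+ 2 @[j --> \oo] --> 0 -> u @ \oo --> 0.
Proof.
move=> u_ge0 sq0; apply/cvgrPdist_lt => e e0.
have e20 : 0 < e ^+ 2 by rewrite exprn_gt0.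
move/cvgrPdist_lt: sq0 => /(_ _ e20); apply: filterS => j.
rewrite !sub0r !normrN ger0_norm ?sqr_ge0// ger0_norm//.
by rewrite ltr_sqr ?nnegrE// ltW.
Qed.

Section Descent_rates.
Variables (K : realType) (h D delta : nat -> K) (hstar c : K).
Hypothesis descent : forall j, h j.+1 + c * delta j ^+ 2 <= h j.
Hypothesis c_gt0 : 0 < c.

Let h_noninc j : h j.+1 <= h j.
Proof.
by apply: le_trans (descent j); rewrite lerDl mulr_ge0 ?sqr_ge0// ltW.
Qed.

(** The Fejer inequalities telescope, and the monotonicity of [h] replaces
    each of their values by the last one. *)
Lemma fejer_rate j : (forall i, h i.+1 + c * D i.+1 <= hstar + c * D i) ->
  j%:R * (h j - hstar) + c * D j <= c * D 0.
Proof.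
move=> fejer; elim: j => [|j IH]; first by rewrite mul0r add0r.
rewrite -natr1 mulrDl mul1r.
have : j%:R * (h j.+1 - hstar) <= j%:R * (h j - hstar).
  by rewrite ler_wpM2l// lerD2r.
have := fejer j; lra.
Qed.

Lemma sum_nonincreasing_steps m k :
    (forall j, 0 <= delta j.+1 <= delta j) ->
  h (m + k.+1)%N + k.+1%:R * (c * delta (m + k)%N ^+ 2) <= h m.
Proof.
move=> mono; elim: k => [|k IH].
  by rewrite addn1 addn0 mul1r.
have := descent (m + k.+1)%N; rewrite -addnS => d.
rewrite -[k.+2%:R]natr1 mulrDl mul1r.
have : k.+1%:R * (c * delta (m + k.+1)%N ^+ 2) <= k.+1%:R * (c * delta (m + k)%N ^+ 2).
  have /andP[d0 d1] := mono (m + k)%N.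
  rewrite ler_wpM2l// ler_pM2l// addnS ler_sqr ?nnegrE//.
  exact: le_trans d0 d1.
lra.
Qed.

(** Nonincreasing steps upgrade square summability to the rate [1/j]: the
    last step is at most the average over the second half of the run, whose
    total decrease is controlled by [fejer_rate] at the middle index. *)
Lemma fejer_step_rate n : (0 < n)%N ->
    (forall i, h i.+1 + c * D i.+1 <= hstar + c * D i) ->
    (forall i, 0 <= D i) -> (forall i, hstar <= h i) ->
    (forall i, 0 <= delta i.+1 <= delta i) ->
  (n%:R * delta n) ^+ 2 <= 4 * D 0.
Proof.
move=> n_gt0 fejer D_ge0 h_ge mono.
pose m := (n - n./2)%N; pose k := n./2.
have mk : (m + k)%N = n by rewrite /m /k; lia.
have mk4 : (n * n <= 4 * (m * k.+1))%N.
  have half : m = k \/ m = k.+1 by rewrite /m /k; lia.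
  by rewrite -mk; case: half => ->; nia.
have := fejer_rate m fejer; have := sum_nonincreasing_steps m k mono.
rewrite mk; have := h_ge (m + k.+1)%N; have := D_ge0 m.
set d2 := delta n ^+ 2; rewrite exprMn -/d2 => Dm hmk step rate.
have d20 : 0 <= d2 by exact: sqr_ge0.
have : m%:R * (k.+1%:R * (c * d2)) <= m%:R * (h m - hstar).
  by rewrite ler_wpM2l//; lra.
have := mulr_ge0 (ltW c_gt0) Dm => cDm step'.
have le1 : c * (m%:R * k.+1%:R * d2) <= c * D 0.
  by have -> : c * (m%:R * k.+1%:R * d2) = m%:R * (k.+1%:R * (c * d2)); [ring|lra].
move: le1; rewrite ler_pM2l// => le1.
have : n%:R ^+ 2 * d2 <= 4 * (m%:R * k.+1%:R) * d2.
  by rewrite ler_wpM2r// expr2 -!natrM ler_nat.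
lra.
Qed.

Lemma descent_steps_vanish m : (forall j, m <= h j) -> (forall j, 0 <= delta j) ->
  delta @ \oo --> 0.
Proof.
move=> h_ge delta_ge0.
have h_cvg : cvg (h @ \oo).
  apply: nonincreasing_is_cvgn; last by exists m => _ [j _ <-].
  by apply/nonincreasing_seqP.
have diff0 : (h j - h j.+1) / c @[j --> \oo] --> 0.
  rewrite -[X in _ --> X](mul0r c^-1) -(subrr (lim (h @ \oo))).
  apply: cvgM; last exact: cvg_cst.
  by apply: cvgB => //; rewrite (cvg_shiftS h).
have sq0 : delta j ^+ 2 @[j --> \oo] --> 0.
  apply: (squeeze_cvgr _ (cvg_cst _) diff0).
  near=> j; rewrite sqr_ge0 /= ler_pdivlMr// mulrC lerBrDl; exact: descent.
exact: sqr_cvg0.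
Unshelve. all: by end_near. Qed.

End Descent_rates.

(** * The dual proximal gradient iteration *)

Section Proximal_gradient.
Variables (K : realType) (W X : hilbertType K).
Variables (T : {linear W -> X}) (Ts : X -> W) (R : X -> K) (L : K).
Hypothesis T_bounded : bounded_near T (nbhs (0 : W)).
Hypothesis Ts_adjoint : is_adjoint T Ts.
Hypothesis R_convex : convex_on_segments R.
Hypothesis L_ge0 : 0 <= L.
Hypothesis R_lip : forall x y, `|R x - R y| <= L * `|x - y|.

Section Gap.
Variables (q : W) (t : K).
Hypothesis t_gt0 : 0 < t.

(** Fenchel-Young at [T y] completes the square. *)
Lemma gap_ge y mu :
  (((2 * t)^-1 * `|y - primal_of Ts q t mu| ^+ 2)%:E <= gap T Ts R q t y mu)%E.
Proof.
rewrite /gap /neg_dual_obj /primal_obj.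
apply: (@le_trans _ _ (((2 * t)^-1 * `|y - q| ^+ 2 + R (T y))%:E +
  ((t / 2 * `|Ts mu| ^+ 2 - inner mu (T q))%:E +
   (inner mu (T y) - R (T y))%:E))%E); last first.
  by rewrite leeD2l// leeD2l// fenchel_young.
rewrite -!EFinD lee_fin /primal_of opprB addrA addrAC.
rewrite sqnormD sqnormZ innerZr -Ts_adjoint linearB innerDl innerNl.
rewrite (innerC mu (T q)) (innerC mu (T y)).
set a := inner _ _; set b := inner _ _.
have -> : (2 * t)^-1 * (`|y - q| ^+ 2 + 2 * (t * (a - b)) + t ^+ 2 * `|Ts mu| ^+ 2)
  = (2 * t)^-1 * `|y - q| ^+ 2 + (a - b) + t / 2 * `|Ts mu| ^+ 2.
  by field; rewrite gt_eqF.
lra.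
Qed.

Lemma gap_ge0 y mu : (0 <= gap T Ts R q t y mu)%E.
Proof.
apply: le_trans (gap_ge y mu); rewrite lee_fin mulr_ge0 ?sqr_ge0//.
by rewrite invr_ge0 mulr_ge0// ltW.
Qed.

(** At [y = q - t Ts mu] the quadratic terms of the two objectives and
    [- (mu, T q)] add up to [- (mu, T y)], which reduces the gap to the
    Fenchel-Young defect of [R] at [(T y, mu)]. *)
Lemma gap_primal_of mu a : conjugate R mu = a%:E ->
  let y := primal_of Ts q t mu in
  gap T Ts R q t y mu = (R (T y) + a - inner mu (T y))%:E.
Proof.
move=> muE y; rewrite /gap /neg_dual_obj /primal_obj muE -!EFinD; congr EFin.
have -> : y - q = - (t *: Ts mu) by rewrite /y /primal_of addrAC subrr add0r.
have -> : inner mu (T y) = inner mu (T q) - t * `|Ts mu| ^+ 2.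
  rewrite /y /primal_of linearB linearZ !innerE.
  by rewrite (innerC mu (T (Ts mu))) Ts_adjoint inner_norm.
rewrite normrN sqnormZ; set n := `|Ts mu| ^+ 2.
have -> : (2 * t)^-1 * (t ^+ 2 * n) = t / 2 * n by field; rewrite gt_eqF.
by field.
Qed.

Lemma neg_dual_obj_fin_num mu :
  conjugate R mu \is a fin_num -> neg_dual_obj T Ts R q t mu \is a fin_num.
Proof. by move=> h; rewrite /neg_dual_obj fin_numD h. Qed.

End Gap.

Section Iterates.
Variables (q : W) (t gamma : K) (mu0 : X).
Hypotheses (t_gt0 : 0 < t) (gamma_gt0 : 0 < gamma).
Hypothesis step_small : gamma * t * opnorm T ^+ 2 <= 1.
Hypothesis mu0_dom : edom (conjugate R) mu0.

Let mu := dual_iterate T Ts R q t gamma mu0.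
Let y := primal_iterate T Ts R q t gamma mu0.
Let H := neg_dual_obj T Ts R q t.
Let step_ge0 : 0 <= gamma * t. Proof. by rewrite mulr_ge0// ltW. Qed.

(** The implicit form of the proximal step: [u] is the primal proximal point
    whose subgradient the new dual iterate is. *)
Lemma dual_iterateS j : exists2 u, mu j + gamma *: T (y j) = mu j.+1 + gamma *: u
  & subdifferential R u (mu j.+1).
Proof.
have [u [p [nuE pu]]] :=
  moreau_decomposition (mu j + gamma *: T (y j)) gamma_gt0 R_convex R_lip.
have -> : mu j.+1 = p by exact: prox_conjugate pu.
by exists u.
Qed.

Lemma conjugate_iterate_fin_num j : conjugate R (mu j) \is a fin_num.
Proof.
case: j => [|j]; first exact: conjugate_fin_num.
by have [u _ /conjugate_subdifferential ->] := dual_iterateS j.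
Qed.

Lemma forward_iterateB i j :
  (mu i + gamma *: T (y i)) - (mu j + gamma *: T (y j))
  = (mu i - mu j) - (gamma * t) *: T (Ts (mu i - mu j)).
Proof.
have yB : y i - y j = - (t *: Ts (mu i - mu j)).
  rewrite (adjointB Ts_adjoint) scalerBr opprB /y /primal_iterate /primal_of.
  by rewrite -/mu opprB addrC addrA subrK.
by rewrite opprD addrACA -scalerBr -linearB yB linearN linearZ scalerN scalerA.
Qed.

(** The three standard ingredients: convexity of the quadratic part at [mu^j],
    its descent lemma (by the step size restriction), and the subgradient
    inequality for [R^*] at [mu^(j+1)], here read off from Fenchel-Young at
    the point [u]. *)
Lemma dual_descent j z :
  (H (mu j.+1) + ((2 * gamma)^-1 * `|z - mu j.+1| ^+ 2)%:E
   <= H z + ((2 * gamma)^-1 * `|z - mu j| ^+ 2)%:E)%E.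
Proof.
have [u nuE pu] := dual_iterateS j.
apply: (@le_trans _ _ ((t / 2 * `|Ts z| ^+ 2 - inner z (T q))%:E +
  (inner z u - R u)%:E + ((2 * gamma)^-1 * `|z - mu j| ^+ 2)%:E)%E); last first.
  by rewrite leeD2r// leeD2l// fenchel_young.
rewrite /H /neg_dual_obj (conjugate_subdifferential pu) -!EFinD lee_fin.
set p := mu j.+1 in nuE pu *; set nu := mu j in nuE *.
have uE v : gamma * inner v u = inner v nu - inner v p
    + gamma * inner v (T q) - gamma * t * inner (Ts v) (Ts nu).
  rewrite -innerZr; have -> : gamma *: u = nu + gamma *: T (y j) - p.
    by rewrite nuE addrAC subrr add0r.
  have -> : T (y j) = T q - t *: T (Ts nu).
    by rewrite /y /primal_iterate /primal_of -/mu linearB linearZ.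
  rewrite !innerE.
  by rewrite (innerC v (T (Ts nu))) Ts_adjoint (innerC (Ts nu)); ring.
have contr : gamma * t * `|Ts (p - nu)| ^+ 2 <= `|p - nu| ^+ 2.
  exact: (step_adjoint_le T_bounded Ts_adjoint step_ge0 step_small).
have sq0 : 0 <= gamma * t * `|Ts (z - nu)| ^+ 2 by rewrite mulr_ge0 ?sqr_ge0.
(* Multiplying by [2 gamma] makes the claim linear in [uE], [contr], [sq0]. *)
have scaled P Y : P + (2 * gamma)^-1 * Y = (2 * gamma)^-1 * (2 * (gamma * P) + Y).
  by field; rewrite gt_eqF.
rewrite !scaled ler_pM2l ?invr_gt0 ?mulr_gt0//.
have := uE z; have := uE p; move: contr sq0.
rewrite !(adjointB Ts_adjoint) -!inner_norm !innerE.
rewrite (innerC nu p) (innerC nu z) (innerC p z).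
rewrite (innerC (Ts nu) (Ts p)) (innerC (Ts nu) (Ts z)).
lra.
Qed.

(** One iteration composes a nonexpansive forward step with a proximal map,
    which is nonexpansive because subgradients are monotone. *)
Lemma dual_step_nonincreasing j : `|mu j.+2 - mu j.+1| <= `|mu j.+1 - mu j|.
Proof.
have [u nuE pu] := dual_iterateS j; have [v nvE pv] := dual_iterateS j.+1.
have := forward_iterateB j.+1 j; rewrite nuE nvE => E.
have := forward_step_nonexpansive T_bounded Ts_adjoint step_ge0 step_small
  (mu j.+1 - mu j).
rewrite -E; apply: le_trans; rewrite -ler_sqr ?nnegrE//.
have -> : mu j.+2 + gamma *: v - (mu j.+1 + gamma *: u)
   = (mu j.+2 - mu j.+1) + gamma *: (v - u) by rewrite opprD addrACA scalerBr.
rewrite (sqnormD (_ - _)) -addrA lerDl addr_ge0 ?sqr_ge0// mulr_ge0// innerZr.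
rewrite pmulr_rge0//; have := pu v; have := pv u; rewrite !innerE; lra.
Qed.

(** The gap is the Fenchel-Young defect at [T y^(j+1)], while the defect at [u]
    is zero; both [R] and [mu^(j+1)] are [L]-Lipschitz, so the gap is at most
    [2 L |T y^(j+1) - u|]. *)
Lemma gap_le_step j :
  (gap T Ts R q t (y j.+1) (mu j.+1) <= (2 * L / gamma * `|mu j.+1 - mu j|)%:E)%E.
Proof.
have [u nuE pu] := dual_iterateS j.
rewrite (gap_primal_of q t_gt0 (conjugate_subdifferential pu)) lee_fin -/(y j.+1).
have Tu : gamma *: (T (y j.+1) - u)
    = (mu j.+1 - mu j) - gamma * t *: T (Ts (mu j.+1 - mu j)).
  rewrite -forward_iterateB nuE scalerBr opprD addrA; congr (_ - _).
  by rewrite addrAC subrr add0r.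
have : `|T (y j.+1) - u| <= `|mu j.+1 - mu j| / gamma.
  rewrite ler_pdivlMr// mulrC -[X in X * _](gtr0_norm gamma_gt0) -normrZ Tu.
  exact: (forward_step_nonexpansive T_bounded Ts_adjoint step_ge0 step_small).
set d := T (y j.+1) - u; move=> d_le.
have := R_lip (T (y j.+1)) u; have := ler_norm (R (T (y j.+1)) - R u).
have : - inner (mu j.+1) d <= L * `|d|.
  rewrite -innerNr; apply: le_trans (inner_le_norm _ _) _.
  by rewrite normrN ler_wpM2r//; exact: subdifferential_norm R_lip L_ge0 pu.
have : L * `|d| <= L * (`|mu j.+1 - mu j| / gamma) by rewrite ler_wpM2l.
rewrite -/d /d innerDr innerNr; lra.
Qed.

Let c := (2 * gamma)^-1.
Let c_gt0 : 0 < c. Proof. by rewrite invr_gt0 mulr_gt0. Qed.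
Let h j := fine (H (mu j)).
Let step j := `|mu j.+1 - mu j|.

Let neg_dual_iterateE j : H (mu j) = (h j)%:E.
Proof.
by rewrite fineK//; apply: neg_dual_obj_fin_num; exact: conjugate_iterate_fin_num.
Qed.

Let gap_iterateE j :
  gap T Ts R q t (y j) (mu j) = (primal_obj T R q t (y j) + h j)%:E.
Proof. by rewrite /gap -/H neg_dual_iterateE. Qed.

Lemma gap_iterate_fin_num j : gap T Ts R q t (y j) (mu j) \is a fin_num.
Proof. by rewrite gap_iterateE. Qed.

Let step_descent j : h j.+1 + c * step j ^+ 2 <= h j.
Proof.
have := dual_descent j (mu j).
rewrite !neg_dual_iterateE -!EFinD lee_fin subrr normr0 expr0n mulr0 addr0.
by rewrite -/c /step distrC.
Qed.

Let weak_duality z j : 0 <= primal_obj T R q t z + h j.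
Proof.
by have := gap_ge0 q t_gt0 z (mu j); rewrite /gap -/H neg_dual_iterateE.
Qed.

Let gap_iterate_real_cvg0 : primal_obj T R q t (y j) + h j @[j --> \oo] --> 0.
Proof.
have step0 : step @ \oo --> 0.
  apply: (descent_steps_vanish step_descent c_gt0 (m := - primal_obj T R q t 0)).
    by move=> j; rewrite -subr_ge0 opprK addrC; exact: weak_duality.
  by move=> j; exact: normr_ge0.
have bound0 : 2 * L / gamma * step j @[j --> \oo] --> 0.
  by rewrite -[X in _ --> X](mulr0 (2 * L / gamma)); apply: cvgM => //; exact: cvg_cst.
rewrite -(cvg_shiftS (fun j => primal_obj T R q t (y j) + h j)).
apply: (squeeze_cvgr _ (cvg_cst _) bound0).
near=> j; rewrite weak_duality /= -lee_fin -gap_iterateE.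
exact: gap_le_step.
Unshelve. all: by end_near. Qed.

Lemma gap_iterate_cvg0 : gap T Ts R q t (y j) (mu j) @[j --> \oo] --> 0%E.
Proof.
under eq_fun do rewrite gap_iterateE.
by apply: cvg_EFin; [exact: nearW|exact: gap_iterate_real_cvg0].
Qed.

Section Rates.
Variable mustar : X.
Hypothesis mustar_min : is_minimizer H mustar.
Let hstar := fine (H mustar).
Let dist j := `|mustar - mu j| ^+ 2.

Let neg_dual_starE : H mustar = (hstar)%:E.
Proof.
rewrite fineK// fin_numE; apply/andP; split.
  apply/eqP => Hoo; have := gap_ge0 q t_gt0 0 mustar.
  by rewrite /gap -/H Hoo.
apply/eqP => Hoo; have := mustar_min (mu 0).
by rewrite Hoo neg_dual_iterateE.
Qed.

Let hstar_le j : hstar <= h j.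
Proof. by rewrite -lee_fin -neg_dual_starE -neg_dual_iterateE. Qed.

Let fejer j : h j.+1 + c * dist j.+1 <= hstar + c * dist j.
Proof.
have := dual_descent j mustar.
by rewrite neg_dual_starE neg_dual_iterateE -!EFinD lee_fin.
Qed.

Let rate j : (0 < j)%N -> h j - hstar <= dist 0 / (2 * gamma * j%:R).
Proof.
move=> j0; have := fejer_rate step_descent c_gt0 j fejer.
have : 0 <= c * dist j by rewrite mulr_ge0 ?sqr_ge0 ?ltW.
have -> : dist 0 / (2 * gamma * j%:R) = c * dist 0 / j%:R.
  by rewrite /c; field; rewrite !gt_eqF ?ltr0n.
by rewrite ler_pdivlMr ?ltr0n//; lra.
Qed.

Lemma dual_value_rate j : (0 < j)%N ->
  (0 <= H (mu j) - H mustar <= (`|mu0 - mustar| ^+ 2 / (2 * gamma * j%:R))%:E)%E.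
Proof.
move=> j0; rewrite neg_dual_starE neg_dual_iterateE -EFinB !lee_fin.
by rewrite subr_ge0 hstar_le /= distrC; exact: rate.
Qed.

Lemma primal_iterate_rate ystar j :
    is_minimizer (primal_obj T R q t) ystar -> (0 < j)%N ->
  `|y j - ystar| <= Num.sqrt (t / (gamma * j%:R)) * `|mu0 - mustar|.
Proof.
move=> ystar_min j0.
(* Both optimal values are below those at the iterates,
   and the sum of the latter is the gap, which tends to zero. *)
have strong_duality : primal_obj T R q t ystar + hstar <= 0.
  rewrite -(cvg_lim _ gap_iterate_real_cvg0)//; apply: limr_ge.
    by apply: cvgP gap_iterate_real_cvg0.
  by near=> i; rewrite lerD// ystar_min.
have s_ge0 : 0 <= t / (gamma * j%:R) by rewrite divr_ge0 ?mulr_ge0// ltW.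
rewrite -ler_sqr ?nnegrE ?mulr_ge0 ?sqrtr_ge0// exprMn sqr_sqrtr//.
have := gap_ge q t_gt0 ystar (mu j).
rewrite /gap -/H neg_dual_iterateE lee_fin -/(y j) distrC.
set n := `|y j - ystar| ^+ 2 => n_le.
have := rate j0; rewrite /dist distrC -/(mu 0).
set d := `|_| ^+ 2 => d_le.
have n_le' : (2 * t)^-1 * n <= d / (2 * gamma * j%:R) by lra.
have -> : t / (gamma * j%:R) * d = (2 * t) * (d / (2 * gamma * j%:R)).
  by field; rewrite !gt_eqF ?ltr0n.
by rewrite -ler_pdivrMl ?mulr_gt0.
Unshelve. all: by end_near. Qed.

Lemma gap_rate j : (2 <= j)%N ->
  (gap T Ts R q t (y j) (mu j)
    <= (4 * L * `|mu0 - mustar| / (gamma * (j%:R - 1)))%:E)%E.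
Proof.
case: j => [|[|j]]// _; apply: le_trans (gap_le_step j.+1) _; rewrite lee_fin.
have mono i : 0 <= step i.+1 <= step i by rewrite normr_ge0 dual_step_nonincreasing.
have := fejer_step_rate step_descent c_gt0 (ltn0Sn j) fejer
  (fun i => sqr_ge0 _) hstar_le mono.
have -> : j.+2%:R - 1 = j.+1%:R :> K by rewrite -[j.+2%:R]natr1 addrK.
have -> : 4 * dist 0 = (2 * `|mu0 - mustar|) ^+ 2.
  by rewrite /dist distrC exprMn; congr (_ * _); ring.
have s_ge0 : 0 <= step j.+1 by exact: normr_ge0.
rewrite ler_sqr ?nnegrE ?mulr_ge0// => s_le; rewrite -/(step j.+1).
rewrite ler_pdivlMr ?mulr_gt0 ?ltr0n//.
have -> : 2 * L / gamma * step j.+1 * (gamma * j.+1%:R)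
  = 2 * L * (j.+1%:R * step j.+1) by field; rewrite gt_eqF.
have -> : 4 * L * `|mu0 - mustar| = 2 * L * (2 * `|mu0 - mustar|) by ring.
by rewrite ler_wpM2l// mulr_ge0.
Qed.

End Rates.

End Iterates.

End Proximal_gradient.

(** * Termination of the tests *)

Section Termination.
Variables (K : realType) (W X : hilbertType K).
Variables (T : {linear W -> X}) (Ts : X -> W) (R : X -> K) (L : K).
Hypothesis T_bounded : bounded_near T (nbhs (0 : W)).
Hypothesis R_convex : convex_on_segments R.
Hypothesis R_lip : forall x y, `|R x - R y| <= L * `|x - y|.

Hypothesis Ts_adjoint : is_adjoint T Ts.
Variables (gradf : W -> W) (sigma : K) (w : W) (t : K).
Hypotheses (t_gt0 : 0 < t) (sigma_gt0 : 0 < sigma).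
Let q := w - t *: gradf w.
Variable pair : nat -> W * X.
Hypothesis gap_fin_num : forall j, gap T Ts R q t (pair j).1 (pair j).2 \is a fin_num.
Hypothesis gap_cvg0 : gap T Ts R q t (pair j).1 (pair j).2 @[j --> \oo] --> 0%E.

Let g j := fine (gap T Ts R q t (pair j).1 (pair j).2).

Let gapE j : gap T Ts R q t (pair j).1 (pair j).2 = (g j)%:E.
Proof. by rewrite fineK. Qed.

Let g_cvg0 : g @ \oo --> 0.
Proof. by have /fine_cvgP[] := gap_cvg0. Qed.

Let g_ge0 j : 0 <= g j.
Proof. by rewrite -lee_fin -gapE; exact: gap_ge0. Qed.

(** A relative test that fails forever bounds the squared distance to [w] by
    a multiple of the vanishing gap. *)
Lemma failed_relative_tests_cvg :
    (forall j, ~ relative_test T Ts R gradf sigma w t (pair j)) ->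
  `|(pair j).1 - w| @[j --> \oo] --> 0.
Proof.
move=> fails; pose s := sigma ^+ 2 / (2 * t).
have s_gt0 : 0 < s by rewrite divr_gt0 ?exprn_gt0 ?mulr_gt0.
apply: sqr_cvg0 => [j|]; first exact: normr_ge0.
have bound0 : g j / s @[j --> \oo] --> 0.
  by rewrite -[X in _ --> X](mul0r s^-1); apply: cvgM => //; exact: cvg_cst.
apply: (squeeze_cvgr _ (cvg_cst _) bound0).
near=> j; rewrite sqr_ge0 /= ler_pdivlMr// mulrC.
have /negP := fails j.
by rewrite /relative_test -/q gapE lee_fin -ltNge => /ltW.
Unshelve. all: by end_near. Qed.

Lemma stationarity_test_stops eps : 0 < eps -> exists j,
  tolerance_test T Ts R gradf t eps w (pair j) \/
  relative_test T Ts R gradf sigma w t (pair j).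
Proof.
move=> eps0; apply: contrapT => none.
have dist0 : `|(pair j).1 - w| @[j --> \oo] --> 0.
  by apply: failed_relative_tests_cvg => j rj; apply: none; exists j; right.
have sqrt0 : Num.sqrt (2 / t * g j) @[j --> \oo] --> 0.
  apply: sqr_cvg0 => [j|]; first exact: sqrtr_ge0.
  have -> : (fun j => Num.sqrt (2 / t * g j) ^+ 2) = (fun j => 2 / t * g j).
    by apply/funext => j; rewrite sqr_sqrtr// mulr_ge0// divr_ge0// ltW.
  by rewrite -[X in _ --> X](mulr0 (2 / t)); apply: cvgM => //; exact: cvg_cst.
have sum0 : `|(pair j).1 - w| / t + Num.sqrt (2 / t * g j) @[j --> \oo] --> 0.
  rewrite -[X in _ --> X](addr0 0); apply: cvgD => //.
  by rewrite -[X in _ --> X](mul0r t^-1); apply: cvgM => //; exact: cvg_cst.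
move/cvgrPdist_le : sum0 => /(_ _ eps0) small.
have [j hj] := filter_ex small.
apply: none; exists j; left; rewrite /tolerance_test -/q gapE -EFinM /=.
rewrite -EFinD lee_fin; apply: le_trans hj.
by rewrite sub0r normrN ler_norm.
Qed.

(** The iterates would converge to [w]; as the gap bounds the suboptimality
    of [y^j], the point [w] would minimize the proximal model centred at
    [w - t grad f(w)], whose optimality condition is stationarity of [w]. *)
Lemma relative_test_stops : ~ stationary gradf (R \o T) w ->
  exists j, relative_test T Ts R gradf sigma w t (pair j).
Proof.
move=> nonstat; apply: contrapT => none; apply: nonstat.
have dist0 : `|(pair j).1 - w| @[j --> \oo] --> 0.
  by apply: failed_relative_tests_cvg => j rj; apply: none; exists j.
have y_cvg : (pair j).1 @[j --> \oo] --> w.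
  apply/cvgrPdist_lt => e e0; move/cvgrPdist_lt : dist0 => /(_ _ e0).
  by apply: filterS => j; rewrite sub0r normrN normr_id distrC.
pose psi z : K := (2 * t)^-1 * `|z - q| ^+ 2 + R (T z).
have psi_cvg : psi (pair j).1 @[j --> \oo] --> psi w.
  apply: (@cvgD K K^o).
    apply: (@cvgM K); first exact: cvg_cst.
    rewrite expr2; under eq_fun do rewrite expr2.
    have h : `|(pair j).1 - q| @[j --> \oo] --> `|w - q|.
      by apply: cvg_norm; apply: cvgB => //; exact: cvg_cst.
    exact: (@cvgM K _ _ _ _ _ _ _ h h).
  have T_cvg : T (pair j).1 @[j --> \oo] --> T w.
    apply: (continuous_cvg _ _ y_cvg).
    exact: (proj1 (linear_bounded_continuous T) T_bounded).
  apply: (continuous_cvg _ _ T_cvg).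
  exact: (@lipschitz_bound_continuous K X R L R_lip).
have w_min v : psi w <= psi v.
  have sum_cvg : psi (pair j).1 - g j @[j --> \oo] --> psi w.
    by rewrite -[X in _ --> X]subr0; apply: cvgB.
  rewrite -(cvg_lim _ sum_cvg)//; apply: limr_le; first by apply: cvgP sum_cvg.
  near=> j; rewrite lerBlDr.
  have := gap_ge0 R Ts_adjoint q t_gt0 v (pair j).2; have := gapE j.
  rewrite /gap; case: neg_dual_obj => // r.
  rewrite -!EFinD lee_fin /primal_obj -/(psi _) -/(psi _) => -[<-]; lra.
have RT_convex : convex_on_segments (R \o T).
  move=> x z s s0 s1 /=; rewrite linearD linearZ linearB; exact: R_convex.
have w_opt x : (R \o T) w + t^-1 / 2 * `|w - q| ^+ 2
    <= (R \o T) x + t^-1 / 2 * `|x - q| ^+ 2.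
  by have := w_min x; rewrite /psi invfM (mulrC 2^-1) /= addrC [leRHS]addrC.
have ti0 : 0 <= t^-1 by rewrite invr_ge0 ltW.
exists (t^-1 *: (q - w)); first exact: prox_optimality ti0 RT_convex w_opt.
by rewrite /q addrAC subrr add0r scalerN scalerA mulVf ?gt_eqF// scale1r subrr.
Unshelve. all: by end_near. Qed.

End Termination.


Theorem theorem5p3 (K : realType) (W X : hilbertType K)
    (T : {linear W -> X}) (Ts : X -> W) (R : X -> K^o) (LR : K)
    (T_bounded : bounded_near T (nbhs (0 : W)))
    (Ts_adjoint : is_adjoint T Ts)
    (R_convex : convex_function [set: convex_lmodType X] R)
    (LR_ge0 : 0 <= LR)
    (R_lipschitz : LR.-lipschitz R) :
  (forall (q : W) (t gamma : K) (mu0 : X),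
    0 < t -> 0 < gamma -> gamma * t * opnorm T ^+ 2 <= 1 ->
    edom (conjugate R) mu0 ->
    let mu := dual_iterate T Ts R q t gamma mu0 in
    let y := primal_iterate T Ts R q t gamma mu0 in
    let H := neg_dual_obj T Ts R q t in
    let G j := gap T Ts R q t (y j) (mu j) in
    [/\ forall j, G j \is a fin_num,
        G j @[j --> \oo] --> 0%E,
        forall j, (1 <= j)%N ->
          (0 <= G j <= (2 * LR / gamma * `|mu j - mu j.-1|)%:E)%E
      & forall (mustar : X) (ystar : W),
          is_minimizer H mustar -> is_minimizer (primal_obj T R q t) ystar ->
          [/\ forall j, (1 <= j)%N ->
                (0 <= H (mu j) - H mustar
                   <= (`|mu0 - mustar| ^+ 2 / (2 * gamma * j%:R))%:E)%E,
              forall j, (1 <= j)%N ->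
                `|y j - ystar| <= Num.sqrt (t / (gamma * j%:R)) * `|mu0 - mustar|
            & forall j, (2 <= j)%N ->
                (G j <= (4 * LR * `|mu0 - mustar| / (gamma * (j%:R - 1)))%:E)%E]])
  /\
  (forall (f : W -> K^o) (gradf : W -> W) (Lf tau sigma : K)
      (gamma : W -> K -> K) (mu0 : W -> K -> X),
    is_gradient f gradf -> continuous gradf ->
    0 <= Lf -> Lf.-lipschitz gradf ->
    (exists m : K, forall w, m <= f w + R (T w)) ->
    0 < tau -> 0 < sigma < 1 ->
    (forall w t, 0 < t ->
       [/\ 0 < gamma w t, gamma w t * t * opnorm T ^+ 2 <= 1
         & edom (conjugate R) (mu0 w t)]) ->
    let pairs := inner_pairs T Ts R gradf gamma mu0 in
    [/\ inner_approximation T Ts R gradf pairs,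
        forall w eps, 0 < eps ->
          stationarity_test_terminates T Ts R gradf tau sigma eps w pairs
      & forall w t, ~ stationary gradf (R \o T) w -> 0 < t ->
          relative_test_terminates T Ts R gradf sigma w t pairs]).
Proof.
have R_conv := convex_function_on_segments R_convex.
have R_lip x y : `|R x - R y| <= LR * `|x - y| by exact: (R_lipschitz (x, y)).
split.
  move=> q t gamma mu0 t0 g0 small mu0_dom mu y H G; split.
  - by move=> j; apply: (gap_iterate_fin_num T Ts R_conv R_lip).
  - exact: (gap_iterate_cvg0 T_bounded Ts_adjoint R_conv LR_ge0 R_lip).
  - case=> // j _; apply/andP; split; first exact: gap_ge0.
    exact: (gap_le_step T_bounded Ts_adjoint R_conv LR_ge0 R_lip).
  - move=> mustar ystar mustar_min ystar_min; split=> j j0.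
    + exact: (dual_value_rate T_bounded Ts_adjoint R_conv R_lip).
    + exact: (primal_iterate_rate T_bounded Ts_adjoint R_conv LR_ge0 R_lip).
    + exact: (gap_rate T_bounded Ts_adjoint R_conv LR_ge0 R_lip).
move=> f gradf Lf tau sigma gamma mu0 _ _ _ _ _ tau0 /andP[sigma0 _] params pairs.
have approx : inner_approximation T Ts R gradf pairs.
  move=> w t t0 G; have [g0 small mu0_dom] := params w t t0; split.
    by move=> j; apply: (gap_iterate_fin_num T Ts R_conv R_lip).
  exact: (gap_iterate_cvg0 T_bounded Ts_adjoint R_conv LR_ge0 R_lip).
split=> // [w eps eps0|w t nonstat t0].
  have [fin cvg0] := approx w tau tau0.
  exact: (stationarity_test_stops Ts_adjoint tau0 sigma0 fin cvg0).
have [fin cvg0] := approx w t t0.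
exact: (relative_test_stops T_bounded R_conv R_lip Ts_adjoint t0 sigma0 fin cvg0).
Qed.
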